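(* Let $G:G_1\overset{d_G}{\longrightarrow}G_0$ and $H:H_1\overset{d_H}{\longrightarrow}H_0$ be isoclinic crossed modules. Then the groups $D_{\mathcal C}(G_0,G_1)$ and $D_{\mathcal C}(H_0,H_1)$ are isomorphic.
   Context: A crossed module $G:G_1\overset{d_G}{\longrightarrow}G_0$ is a group homomorphism $d_G:G_1\to G_0$ together with a left action of $G_0$ on $G_1$ by automorphisms, written ${}^{g_0}g_1$, such that $d_G({}^{g_0}g_1)=g_0d_G(g_1)g_0^{-1}$ and ${}^{d_G(g_1)}g_1'=g_1g_1'g_1^{-1}$. A morphism from $G$ to $G':G_1'\overset{d'}{\longrightarrow}G_0'$ is a pair $(\alpha,\beta)$ of group homomorphisms $\alpha:G_1\to G_1'$, $\beta:G_0\to G_0'$ with $\beta d_G=d'\alpha$ and $\alpha({}^{g_0}g_1)={}^{\beta(g_0)}\alpha(g_1)$; it is an isomorphism if both components are bijective. Put $G_1^{G_0}=\{g_1\in G_1:{}^{g_0}g_1=g_1\ \forall g_0\in G_0\}$, $St_{G_0}(G_1)=\{g_0\in G_0:{}^{g_0}g_1=g_1\ \forall g_1\in G_1\}$, and let $D_{G_0}(G_1)$ be the subgroup of $G_1$ generated by all ${}^{g_0}g_1g_1^{-1}$. The center of $G$ is $Z(G):G_1^{G_0}\to St_{G_0}(G_1)\cap Z(G_0)$ and the commutator subcrossed module is $[G,G]:D_{G_0}(G_1)\to[G_0,G_0]$ (maps and actions restricted from $G$). The quotient $G/Z(G)$ is the crossed module $\overline{G_1}\to\overline{G_0}$ with induced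 map and action, where $\overline{G_1}=G_1/G_1^{G_0}$, $\overline{G_0}=G_0/(St_{G_0}(G_1)\cap Z(G_0))$. There are well-defined maps $c_1^G:\overline{G_1}\times\overline{G_0}\to D_{G_0}(G_1)$, $(\overline{g_1},\overline{g_0})\mapsto{}^{g_0}g_1g_1^{-1}$, and $c_0^G:\overline{G_0}\times\overline{G_0}\to[G_0,G_0]$, $(\overline{g_0},\overline{g_0'})\mapsto[g_0,g_0']=g_0g_0'g_0^{-1}g_0'^{-1}$. Crossed modules $G$ and $H$ are isoclinic if there exist crossed module isomorphisms $(\eta_1,\eta_0):G/Z(G)\to H/Z(H)$ and $(\xi_1,\xi_0):[G,G]\to[H,H]$ such that $\xi_1\circ c_1^G=c_1^H\circ(\eta_1\times\eta_0)$ and $\xi_0\circ c_0^G=c_0^H\circ(\eta_0\times\eta_0)$. A derivation is a map $\partial:G_0\to G_1$ with $\partial(xy)=\partial(x)\,{}^{x}\partial(y)$ for all $x,y\in G_0$. The set of derivations is a monoid under $(\partial_1\circ\partial_2)(g_0)=\partial_1\big(d_G\partial_2(g_0)\,g_0\big)\,\partial_2(g_0)$, with identity the trivial map; the Whitehead group $D(G_0,G_1)$ is its group of units. $D_{\mathcal C}(G_0,G_1)$ is the subgroup of those $\delta\in D(G_0,G_1)$ for which there exists $g_1\in G_1$ such that $\delta(g_0)=g_1\,{}^{g_0}g_1^{-1}$ for all $g_0\in G_0$. *)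

(* Defs.v *)
From HB Require Import structures.
#[warnings="-notation-overridden"]
From mathcomp Require Import all_boot boolp.

Set Implicit Arguments.
Unset Strict Implicit.
Unset Printing Implicit Defensive.

Local Open Scope group_scope.
Local Open Scope quotient_scope.

Definition group_isomorphic (A B : groupType) : Prop :=
  exists f : A -> B, {morph f : x y / x * y} /\ bijective f.

(* [~ x, y] of MathComp is x^-1 * y^-1 * x * y, which is not the convention
   wanted here. *)
Definition commutator (A : groupType) (x y : A) : A := x * y * x^-1 * y^-1.

Record subgroup (A : groupType) := Subgroup {
  subgroup_pred :> {pred A};
  subgroupP : group_closed subgroup_pred }.

Section SubgroupGroup.
Variables (A : groupType) (S : subgroup A).

Record subgroup_sort : predArgType :=
  SubgroupElt { subgroup_val : A; _ : subgroup_val \in S }.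

HB.instance Definition _ := [isSub for subgroup_val].
HB.instance Definition _ := [Choice of subgroup_sort by <:].
HB.instance Definition _ :=
  SubChoice_isSubGroup.Build A (fun x => x \in S) subgroup_sort (subgroupP S).

Lemma sub1 : 1 \in S. Proof. by case: (subgroupP S). Qed.
Lemma subM x y : x \in S -> y \in S -> x * y \in S.
Proof. exact: (group_closedM (subgroupP S)). Qed.
Lemma subV x : x \in S -> x^-1 \in S.
Proof. exact: (group_closedV (subgroupP S)). Qed.
End SubgroupGroup.

Section Generated.
Variables (A : groupType) (P : A -> Prop).

Definition generated_pred : {pred A} := fun x =>
  `[< forall S : subgroup A, (forall y, P y -> y \in S) -> x \in S >].

Lemma generated_closed : group_closed generated_pred.
Proof.
split=> [|x y /asboolP Gx /asboolP Gy]; apply/asboolP => S PS.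
  exact: sub1.
by apply: subM; [apply: Gx | apply/subV/Gy].
Qed.

Definition generated : subgroup A := Subgroup generated_closed.

Lemma mem_generated x : P x -> x \in generated.
Proof. by move=> Px; apply/asboolP => S; apply. Qed.

Lemma generated_sub (S : subgroup A) :
  (forall y, P y -> y \in S) -> {subset generated <= S}.
Proof. by move=> PS x /asboolP; apply. Qed.
End Generated.

Definition normal_subgroup (A : groupType) (N : subgroup A) : Prop :=
  forall x g, x \in N -> g * x * g^-1 \in N.

Section QuotientGroup.
Variables (A : groupType) (N : subgroup A) (nN : normal_subgroup N).

Definition coset_rel : rel A := fun x y => x^-1 * y \in N.

Lemma coset_rel_refl : reflexive coset_rel.
Proof. by move=> x; rewrite /coset_rel mulVg sub1. Qed.

Lemma coset_rel_sym : symmetric coset_rel.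
Proof.
have sym x y : coset_rel x y -> coset_rel y x.
  by rewrite /coset_rel => /subV; rewrite invgM invgK.
by move=> x y; apply/idP/idP; apply: sym.
Qed.

Lemma coset_rel_trans : transitive coset_rel.
Proof.
by move=> y x z /subM/[apply]; rewrite -mulgA mulVKg.
Qed.

Canonical coset_equiv :=
  EquivRel coset_rel coset_rel_refl coset_rel_sym coset_rel_trans.

(* The argument nN makes the group structure inferable from the type. *)
Definition quotient_sort & normal_subgroup N := {eq_quot coset_equiv}.
Local Notation Q := (quotient_sort nN).

HB.instance Definition _ := EqQuotient.on Q.
HB.instance Definition _ := Choice.on Q.

Lemma coset_eqP (x y : A) : reflect (\pi_Q x = \pi_Q y) (x^-1 * y \in N).
Proof. exact: (@eqquotP A coset_equiv Q). Qed.

Lemma quotient_ind (P : Q -> Prop) : (forall x, P (\pi_Q x)) -> forall u, P u.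
Proof. exact: quotW. Qed.

Definition quotient_mul (u v : Q) : Q := \pi_Q (repr u * repr v).
Definition quotient_one : Q := \pi_Q 1.
Definition quotient_inv (u : Q) : Q := \pi_Q (repr u)^-1.

Lemma quotient_mulE x y : quotient_mul (\pi_Q x) (\pi_Q y) = \pi_Q (x * y).
Proof.
apply/coset_eqP.
have /coset_eqP Nx : \pi_Q (repr (\pi_Q x)) = \pi_Q x by rewrite reprK.
have /coset_eqP Ny : \pi_Q (repr (\pi_Q y)) = \pi_Q y by rewrite reprK.
set x' := repr _ in Nx *; set y' := repr _ in Ny *.
have -> : (x' * y')^-1 * (x * y) =
          (y'^-1 * (x'^-1 * x) * (y'^-1)^-1) * (y'^-1 * y).
  by rewrite invgM invgK -!mulgA mulVKg.
by apply: subM => //; apply: nN.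
Qed.

Lemma quotient_invE x : quotient_inv (\pi_Q x) = \pi_Q x^-1.
Proof.
apply/coset_eqP.
have /coset_eqP Nx : \pi_Q x = \pi_Q (repr (\pi_Q x)) by rewrite reprK.
set x' := repr _ in Nx *.
have -> : x'^-1^-1 * x^-1 = x * (x^-1 * x') * x^-1.
  by rewrite invgK mulVKg.
exact: nN.
Qed.

Lemma quotient_mulA : associative quotient_mul.
Proof.
move=> u v w; elim/quotient_ind: u => x; elim/quotient_ind: v => y; elim/quotient_ind: w => z.
by rewrite !quotient_mulE mulgA.
Qed.
Lemma quotient_mul1 : left_id quotient_one quotient_mul.
Proof. by move=> u; elim/quotient_ind: u => x; rewrite quotient_mulE mul1g. Qed.
Lemma quotient_1mul : right_id quotient_one quotient_mul.
Proof. by move=> u; elim/quotient_ind: u => x; rewrite quotient_mulE mulg1. Qed.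
Lemma quotient_mulV : left_inverse quotient_one quotient_inv quotient_mul.
Proof.
by move=> u; elim/quotient_ind: u => x; rewrite quotient_invE quotient_mulE mulVg.
Qed.
Lemma quotient_Vmul : right_inverse quotient_one quotient_inv quotient_mul.
Proof.
by move=> u; elim/quotient_ind: u => x; rewrite quotient_invE quotient_mulE mulgV.
Qed.

HB.instance Definition _ := isGroup.Build Q
  quotient_mulA quotient_mul1 quotient_1mul quotient_mulV quotient_Vmul.

Lemma pi_quotientM x y : \pi_Q (x * y) = \pi_Q x * \pi_Q y.
Proof. by rewrite -quotient_mulE. Qed.
End QuotientGroup.

(* The group of units of a monoid: an element is carried together with its
   (unique) two-sided inverse. *)
Record units (M : monoidType) := Units {
  units_val :> M;
  units_inv : M;
  units_mulV : units_val * units_inv = 1;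
  units_Vmul : units_inv * units_val = 1 }.

Section UnitsGroup.
Variable M : monoidType.
Implicit Types u v : units M.

HB.instance Definition _ := gen_eqMixin (units M).
HB.instance Definition _ := gen_choiceMixin (units M).

Lemma units_val_inj : injective (@units_val M).
Proof.
case=> [u u' uu' u'u] [v v' vv' v'v] /= uv; subst v.
have e : u' = v' by rewrite -[u']mulg1 -vv' mulgA u'u mul1g.
by subst v'; congr Units; apply: Prop_irrelevance.
Qed.

Definition units_one : units M := Units (mul1g 1) (mul1g 1).

Lemma units_mul_subproof1 u v :
  (units_val u * units_val v) * (units_inv v * units_inv u) = 1.
Proof. by rewrite -mulgA (mulgA (units_val v)) units_mulV mul1g units_mulV. Qed.
Lemma units_mul_subproof2 u v :
  (units_inv v * units_inv u) * (units_val u * units_val v) = 1.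
Proof. by rewrite -mulgA (mulgA (units_inv u)) units_Vmul mul1g units_Vmul. Qed.

Definition units_mul u v : units M :=
  Units (units_mul_subproof1 u v) (units_mul_subproof2 u v).
Definition units_invg u : units M := Units (units_Vmul u) (units_mulV u).

Lemma units_mulA : associative units_mul.
Proof. by move=> u v w; apply: units_val_inj; rewrite /= mulgA. Qed.
Lemma units_mul1 : left_id units_one units_mul.
Proof. by move=> u; apply: units_val_inj; rewrite /= mul1g. Qed.
Lemma units_1mul : right_id units_one units_mul.
Proof. by move=> u; apply: units_val_inj; rewrite /= mulg1. Qed.
Lemma units_invL : left_inverse units_one units_invg units_mul.
Proof. by move=> u; apply: units_val_inj; rewrite /= units_Vmul. Qed.
Lemma units_invR : right_inverse units_one units_invg units_mul.
Proof. by move=> u; apply: units_val_inj; rewrite /= units_mulV. Qed.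

HB.instance Definition _ := isGroup.Build (units M)
  units_mulA units_mul1 units_1mul units_invL units_invR.
End UnitsGroup.

Record crossedModule := CrossedModule {
  cm1 : groupType;
  cm0 : groupType;
  bd : cm1 -> cm0;
  act : cm0 -> cm1 -> cm1;
  bdM : {morph bd : x y / x * y};
  act1 : forall x, act 1 x = x;
  actA : forall g h x, act (g * h) x = act g (act h x);
  actM : forall g, {morph act g : x y / x * y};
  bd_act : forall g x, bd (act g x) = g * bd x * g^-1;
  peiffer : forall x y, act (bd x) y = x * y * x^-1 }.

Arguments bd {c} _.
Arguments act {c} _ _.

Record cm_morphism (G H : crossedModule) := CmMorphism {
  mor1 : cm1 G -> cm1 H;
  mor0 : cm0 G -> cm0 H;
  mor1M : {morph mor1 : x y / x * y};
  mor0M : {morph mor0 : g h / g * h};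
  mor_bd : forall x, mor0 (bd x) = bd (mor1 x);
  mor_act : forall g x, mor1 (act g x) = act (mor0 g) (mor1 x) }.

Definition cm_isomorphism (G H : crossedModule) (f : cm_morphism G H) : Prop :=
  bijective (mor1 f) /\ bijective (mor0 f).

Section CrossedModuleTheory.
Variable G : crossedModule.
Implicit Types (g h : cm0 G) (x y : cm1 G).

Lemma actg1 g : act g (1 : cm1 G) = 1.
Proof. by apply: (mulgI (act g (1 : cm1 G))); rewrite -actM !mulg1. Qed.

Lemma actV g x : act g x^-1 = (act g x)^-1.
Proof. by apply: (mulgI (act g x)); rewrite -actM !mulgV actg1. Qed.

Lemma bd1 : bd (1 : cm1 G) = 1.
Proof. by apply: (mulgI (bd (1 : cm1 G))); rewrite -bdM !mulg1. Qed.

Lemma bdV x : bd x^-1 = (bd x)^-1.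
Proof. by apply: (mulgI (bd x)); rewrite -bdM !mulgV bd1. Qed.

Lemma actK g x : act g^-1 (act g x) = x.
Proof. by rewrite -actA mulVg act1. Qed.
End CrossedModuleTheory.

Record subCrossedModule (G : crossedModule) := SubCrossedModule {
  scm1 : subgroup (cm1 G);
  scm0 : subgroup (cm0 G);
  scm_bd : forall x, x \in scm1 -> bd x \in scm0;
  scm_act : forall g x, g \in scm0 -> x \in scm1 -> act g x \in scm1 }.

Section SubCrossedModuleIsCrossedModule.
Variables (G : crossedModule) (S : subCrossedModule G).
Local Notation S1 := (subgroup_sort (scm1 S)).
Local Notation S0 := (subgroup_sort (scm0 S)).

Definition scm_bd_fun (x : S1) : S0 := SubgroupElt (scm_bd (valP x)).
Definition scm_act_fun (g : S0) (x : S1) : S1 :=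
  SubgroupElt (scm_act (valP g) (valP x)).

Lemma scm_bdM : {morph scm_bd_fun : x y / x * y}.
Proof. by move=> x y; apply: val_inj; rewrite /= bdM. Qed.
Lemma scm_act1 x : scm_act_fun 1 x = x.
Proof. by apply: val_inj; rewrite /= act1. Qed.
Lemma scm_actA g h x :
  scm_act_fun (g * h) x = scm_act_fun g (scm_act_fun h x).
Proof. by apply: val_inj; rewrite /= actA. Qed.
Lemma scm_actM g : {morph scm_act_fun g : x y / x * y}.
Proof. by move=> x y; apply: val_inj; rewrite /= actM. Qed.
Lemma scm_bd_act g x :
  scm_bd_fun (scm_act_fun g x) = g * scm_bd_fun x * g^-1.
Proof. by apply: val_inj; rewrite /= bd_act. Qed.
Lemma scm_peiffer x y : scm_act_fun (scm_bd_fun x) y = x * y * x^-1.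
Proof. by apply: val_inj; rewrite /= peiffer. Qed.

Definition scm_crossedModule : crossedModule :=
  CrossedModule scm_bdM scm_act1 scm_actA scm_actM scm_bd_act scm_peiffer.
End SubCrossedModuleIsCrossedModule.

Record normal_scm (G : crossedModule) (N : subCrossedModule G) : Prop :=
  NormalScm {
    nscm0 : normal_subgroup (scm0 N);
    nscm_act : forall g x, x \in scm1 N -> act g x \in scm1 N;
    nscm_comm : forall n x, n \in scm0 N -> act n x * x^-1 \in scm1 N }.

Section QuotientCrossedModule.
Variables (G : crossedModule) (N : subCrossedModule G) (nN : normal_scm N).

Lemma nscm1 : normal_subgroup (scm1 N).
Proof. by move=> x g xN; rewrite -peiffer; apply: (nscm_act nN). Qed.

Local Notation Q1 := (quotient_sort nscm1).
Local Notation Q0 := (quotient_sort (nscm0 nN)).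

Definition qcm_bd (u : Q1) : Q0 := \pi_Q0 (bd (repr u)).
Definition qcm_act (a : Q0) (u : Q1) : Q1 := \pi_Q1 (act (repr a) (repr u)).

Lemma qcm_bdE x : qcm_bd (\pi_Q1 x) = \pi_Q0 (bd x).
Proof.
apply/coset_eqP; rewrite -bdV -bdM; apply: scm_bd.
by apply/(coset_eqP nscm1); rewrite reprK.
Qed.

Lemma qcm_actE g x : qcm_act (\pi_Q0 g) (\pi_Q1 x) = \pi_Q1 (act g x).
Proof.
have /coset_eqP Ng : \pi_Q0 g = \pi_Q0 (repr (\pi_Q0 g)) by rewrite reprK.
have Ex : \pi_Q1 (repr (\pi_Q1 x)) = \pi_Q1 x by rewrite reprK.
rewrite /qcm_act; set g' := repr _ in Ng *; set x' := repr _ in Ex *.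
transitivity (\pi_Q1 (act g x')); last first.
  apply/coset_eqP; rewrite -actV -actM; apply: (nscm_act nN).
  exact/(coset_eqP nscm1).
apply/coset_eqP.
rewrite -[g'](mulVKg g) actA -!actV -actM; apply: (nscm_act nN).
move: (g^-1 * g') Ng => n Nn.
have /subV/nscm1-/(_ x'^-1) := nscm_comm nN x' Nn.
by rewrite invgM !invgK mulKg actV.
Qed.

Lemma qcm_bdM : {morph qcm_bd : u v / u * v}.
Proof.
move=> u v; elim/quotient_ind: u => x; elim/quotient_ind: v => y.
by rewrite -pi_quotientM !qcm_bdE bdM pi_quotientM.
Qed.
Lemma qcm_act1 u : qcm_act 1 u = u.
Proof. by elim/quotient_ind: u => x; rewrite -[1]/(\pi_Q0 1) qcm_actE act1. Qed.
Lemma qcm_actA a b u : qcm_act (a * b) u = qcm_act a (qcm_act b u).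
Proof.
elim/quotient_ind: a => g; elim/quotient_ind: b => h; elim/quotient_ind: u => x.
by rewrite -pi_quotientM !qcm_actE actA.
Qed.
Lemma qcm_actM a : {morph qcm_act a : u v / u * v}.
Proof.
elim/quotient_ind: a => g; move=> u v; elim/quotient_ind: u => x; elim/quotient_ind: v => y.
by rewrite -pi_quotientM !qcm_actE actM pi_quotientM.
Qed.
Lemma qcm_bd_act a u : qcm_bd (qcm_act a u) = a * qcm_bd u * a^-1.
Proof.
elim/quotient_ind: a => g; elim/quotient_ind: u => x.
rewrite !qcm_actE !qcm_bdE bd_act !pi_quotientM.
by rewrite -[in LHS]quotient_invE.
Qed.
Lemma qcm_peiffer u v : qcm_act (qcm_bd u) v = u * v * u^-1.
Proof.
elim/quotient_ind: u => x; elim/quotient_ind: v => y.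
by rewrite qcm_bdE qcm_actE peiffer !pi_quotientM -[in LHS]quotient_invE.
Qed.

Definition quotient_cm : crossedModule :=
  CrossedModule qcm_bdM qcm_act1 qcm_actA qcm_actM qcm_bd_act qcm_peiffer.
End QuotientCrossedModule.

Section CenterCommutator.
Variable G : crossedModule.
Implicit Types (g h : cm0 G) (x y : cm1 G).

Definition fixed_pred : {pred cm1 G} := fun x => `[< forall g, act g x = x >].

Lemma fixed_closed : group_closed fixed_pred.
Proof.
split=> [|x y /asboolP fx /asboolP fy]; apply/asboolP => g; first exact: actg1.
by rewrite actM actV fx fy.
Qed.

Definition fixed : subgroup (cm1 G) := Subgroup fixed_closed.

Definition central_stab_pred : {pred cm0 G} :=
  fun g => `[< (forall x, act g x = x) /\ (forall h, commute g h) >].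

Lemma central_stab_closed : group_closed central_stab_pred.
Proof.
split=> [|g h /asboolP[sg cg] /asboolP[sh ch]]; apply/asboolP; split.
- exact: act1.
- by move=> h; apply/commute_sym/commute1.
- by move=> x; rewrite actA sg -{1}[x]sh actK.
- move=> k; apply/commute_sym/commuteM; first exact/commute_sym/cg.
  by apply/commuteV/commute_sym/ch.
Qed.

Definition central_stab : subgroup (cm0 G) := Subgroup central_stab_closed.

Lemma center_bd x : x \in fixed -> bd x \in central_stab.
Proof.
move=> /asboolP fx; apply/asboolP; split=> [y|h].
  have xy : x * y = y * x by rewrite -{1}(fx (bd y)) peiffer mulgVK.
  by rewrite peiffer xy mulgK.
by rewrite /commute -{1}(fx h) bd_act mulgVK.
Qed.

Lemma center_act g x : g \in central_stab -> x \in fixed -> act g x \in fixed.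
Proof. by move=> _ fx; have /asboolP-> := fx. Qed.

Definition center : subCrossedModule G :=
  SubCrossedModule center_bd center_act.

Lemma center_normal : normal_scm center.
Proof.
split=> [n g nZ|g x xF|n x /asboolP[sn _]].
- have /asboolP[_ cn] := nZ.
  by rewrite -(cn g) mulgK.
- by have /asboolP-> := xF.
- by rewrite sn mulgV sub1.
Qed.

Definition center_quotient : crossedModule := quotient_cm center_normal.

Definition displacement : subgroup (cm1 G) :=
  generated (fun y => exists g x, y = act g x * x^-1).

Definition derived : subgroup (cm0 G) :=
  generated (fun k => exists g h, k = commutator g h).

Lemma mem_displacement g x : act g x * x^-1 \in displacement.
Proof. by apply: mem_generated; exists g, x. Qed.

Lemma mem_derived g h : commutator g h \in derived.
Proof. by apply: mem_generated; exists g, h. Qed.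

Lemma commutator_bd x : x \in displacement -> bd x \in derived.
Proof.
move=> /asboolP Dx.
have clo : group_closed [pred y : cm1 G | bd y \in derived].
  split=> [|y z]; rewrite !inE ?bd1 ?sub1 // bdM bdV => yD zD.
  exact/subM/subV.
apply: (Dx (Subgroup clo)) => _ [g [y ->]].
by rewrite inE bdM bdV bd_act; apply: mem_derived.
Qed.

Lemma commutator_act g x :
  g \in derived -> x \in displacement -> act g x \in displacement.
Proof.
move=> _ xD; rewrite -[act g x](mulgVK x).
by apply: subM => //; apply: mem_displacement.
Qed.

Definition commutator_scm : subCrossedModule G :=
  SubCrossedModule commutator_bd commutator_act.

Definition commutator_cm : crossedModule := scm_crossedModule commutator_scm.

(* c_1 and c_0 are defined on chosen representatives; c1E and c0E state that
   the choice is irrelevant. *)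
Definition c1 (u : cm1 center_quotient) (a : cm0 center_quotient) :
    cm1 commutator_cm :=
  SubgroupElt (mem_displacement (repr a) (repr u)).

Definition c0 (a b : cm0 center_quotient) : cm0 commutator_cm :=
  SubgroupElt (mem_derived (repr a) (repr b)).

Lemma c1E x g :
  val (c1 (\pi_(cm1 center_quotient) x) (\pi_(cm0 center_quotient) g))
  = act g x * x^-1.
Proof.
rewrite /c1 /=.
have /coset_eqP : \pi_(cm1 center_quotient) x =
  \pi_(cm1 center_quotient) (repr (\pi_(cm1 center_quotient) x)).
  by rewrite reprK.
have /coset_eqP : \pi_(cm0 center_quotient) g =
  \pi_(cm0 center_quotient) (repr (\pi_(cm0 center_quotient) g)).
  by rewrite reprK.
set g' := repr _; set x' := repr _ => /asboolP[sg _] /asboolP fx.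
rewrite -[g'](mulVKg g) -[x'](mulVKg x) actA sg actM fx invgM.
by rewrite mulgA mulgK.
Qed.

Lemma c0E g h :
  val (c0 (\pi_(cm0 center_quotient) g) (\pi_(cm0 center_quotient) h))
  = commutator g h.
Proof.
rewrite /c0 /=.
have /coset_eqP : \pi_(cm0 center_quotient) g =
  \pi_(cm0 center_quotient) (repr (\pi_(cm0 center_quotient) g)).
  by rewrite reprK.
have /coset_eqP : \pi_(cm0 center_quotient) h =
  \pi_(cm0 center_quotient) (repr (\pi_(cm0 center_quotient) h)).
  by rewrite reprK.
set h' := repr _; set g' := repr _ => /asboolP[_ ch] /asboolP[_ cg].
rewrite -[g'](mulVKg g) -[h'](mulVKg h) /commutator.
move: (g^-1 * g') (h^-1 * h') cg ch => m n cm cn.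
have -> : g * m * (h * n) = g * h * n * m.
  by rewrite -!mulgA [m * _]cm !mulgA.
by rewrite !invgM !mulgA mulgK -(mulgA _ n) [n * _]cn !mulgA mulgK.
Qed.
End CenterCommutator.

Definition isoclinic (G H : crossedModule) : Prop :=
  exists (eta : cm_morphism (center_quotient G) (center_quotient H))
         (xi : cm_morphism (commutator_cm G) (commutator_cm H)),
  [/\ cm_isomorphism eta, cm_isomorphism xi,
      forall u a, mor1 xi (c1 u a) = c1 (mor1 eta u) (mor0 eta a) &
      forall a b, mor0 xi (c0 a b) = c0 (mor0 eta a) (mor0 eta b)].

Record derivation (G : crossedModule) := Derivation {
  der_fun :> cm0 G -> cm1 G;
  derM : forall g h, der_fun (g * h) = der_fun g * act g (der_fun h) }.

Section DerivationMonoid.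
Variable G : crossedModule.
Implicit Types (p q r : derivation G) (g h : cm0 G).

HB.instance Definition _ := gen_eqMixin (derivation G).
HB.instance Definition _ := gen_choiceMixin (derivation G).

Lemma derP p q : p =1 q -> p = q.
Proof.
case: p q => [p pM] [q qM] /= /funext e; subst q.
by congr Derivation; apply: Prop_irrelevance.
Qed.

Definition der_one_fun (g : cm0 G) : cm1 G := 1.
Lemma der_one_subproof g h :
  der_one_fun (g * h) = der_one_fun g * act g (der_one_fun h).
Proof. by rewrite /der_one_fun actg1 mulg1. Qed.
Definition der_one := Derivation der_one_subproof.

Definition der_comp_fun p q g : cm1 G := p (bd (q g) * g) * q g.
Lemma der_comp_subproof p q g h :
  der_comp_fun p q (g * h) =
  der_comp_fun p q g * act g (der_comp_fun p q h).
Proof.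
rewrite /der_comp_fun (derM q) bdM bd_act.
have -> : bd (q g) * (g * bd (q h) * g^-1) * (g * h) =
          (bd (q g) * g) * (bd (q h) * h) by rewrite !mulgA mulgVK.
rewrite derM actA peiffer actM.
by rewrite !mulgA mulgVK.
Qed.
Definition der_comp p q := Derivation (der_comp_subproof p q).

Lemma der_compA : associative der_comp.
Proof.
move=> p q r; apply: derP => g.
by rewrite /= /der_comp_fun /= /der_comp_fun bdM !mulgA.
Qed.
Lemma der_comp1 : left_id der_one der_comp.
Proof.
by move=> p; apply: derP => g; rewrite /= /der_comp_fun /= /der_one_fun mul1g.
Qed.
Lemma der_1comp : right_id der_one der_comp.
Proof.
move=> p; apply: derP => g.
by rewrite /= /der_comp_fun /= /der_one_fun bd1 mul1g mulg1.
Qed.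

HB.instance Definition _ :=
  isMonoid.Build (derivation G) der_compA der_comp1 der_1comp.
End DerivationMonoid.

Definition whitehead (G : crossedModule) : groupType := units (derivation G).

Section InnerDerivations.
Variable G : crossedModule.

Definition DC_pred : {pred whitehead G} := fun d =>
  `[< exists x : cm1 G, forall g : cm0 G,
        (units_val d : derivation G) g = x * act g x^-1 >].

Lemma DC_closed : group_closed DC_pred.
Proof.
split=> [|d e /asboolP[x dx] /asboolP[y ey]]; apply/asboolP.
  by exists 1 => g; rewrite actV actg1 mulgV.
pose i (z : cm1 G) g := z * act g z^-1.
have iE z u g : i z (bd u * g) * u = z * u * act g z^-1.
  by rewrite /i actA peiffer !mulgA mulgVK.
have iM z w g : i z (bd (i w g) * g) * i w g = i (z * w) g.
  by rewrite iE /i invgM actM !mulgA.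
have ei g : (units_inv e : derivation G) g = i y^-1 g.
  pose e' := units_inv e : derivation G.
  have e1 h : units_val e (bd (e' h) * h) * e' h = 1.
    by have /(congr1 (fun p : derivation G => p h)) := units_mulV e.
  have {}e1 : i y (bd (e' g) * g) * e' g = 1 by rewrite /i -ey e1.
  rewrite iE in e1.
  have {}e1 : y * e' g = act g y.
    by apply: (mulIg (act g y^-1)); rewrite e1 actV mulgV.
  by rewrite /i invgK -e1 mulKg.
exists (x * y^-1) => g.
by rewrite -[RHS]iM -ei /i -dx.
Qed.

Definition DC_subgroup : subgroup (whitehead G) := Subgroup DC_closed.
End InnerDerivations.

Definition DC (G : crossedModule) : groupType := subgroup_sort (DC_subgroup G).

(* Main.v *)
Require Import Defs.
#[warnings="-notation-overridden"]
From mathcomp Require Import all_boot boolp.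

Set Implicit Arguments.
Unset Strict Implicit.
Unset Printing Implicit Defensive.

Local Open Scope group_scope.
Local Open Scope quotient_scope.

(** For [x] in [cm1 G] let [inner x] be the derivation
    [g |-> x * act g x^-1].  By the Peiffer identity, composition of
    derivations satisfies [inner x o inner y = inner (x * y)], so [inner] is a
    homomorphism from [cm1 G] to the Whitehead group whose image is [DC G].  Its
    kernel consists of the [x] with [x = act g x] for all [g], that is, of
    [fixed G], so the first isomorphism theorem gives
    [cm1 G / fixed G ~ DC G] ([center_quotient_isomorphic_DC]).  The left-hand
    side is the top group of [G / Z(G)], and an isoclinism provides an
    isomorphism between these top groups for [G] and [H]. *)

Lemma group_isomorphic_sym (A B : groupType) :
  group_isomorphic A B -> group_isomorphic B A.
Proof.
case=> f [fM [g fK gK]]; exists g; split; last by exists f.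
by move=> x y; apply: (can_inj fK); rewrite fM !gK.
Qed.

Lemma group_isomorphic_trans (A B C : groupType) :
  group_isomorphic A B -> group_isomorphic B C -> group_isomorphic A C.
Proof.
case=> f [fM fB] [g [gM gB]]; exists (g \o f); split; last exact: bij_comp.
by move=> x y; rewrite /= fM gM.
Qed.

(** First isomorphism theorem; the condition on fibres is the one on the kernel,
    in the form in which [coset_eqP] compares cosets. *)
Lemma quotient_isomorphic (A B : groupType) (N : subgroup A)
    (nN : normal_subgroup N) (f : A -> B) :
  {morph f : x y / x * y} -> (forall b, exists a, f a = b) ->
  (forall x y, f x = f y <-> x^-1 * y \in N) ->
  group_isomorphic (quotient_sort nN) B.
Proof.
move=> fM f_surj f_fibre; pose Q : groupType := quotient_sort nN.
pose phi (u : Q) := f (repr u).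
have phiE x : phi (\pi_Q x) = f x.
  by apply/f_fibre/(coset_eqP nN); rewrite reprK.
exists phi; split.
  move=> u v; elim/quotient_ind: u => x; elim/quotient_ind: v => y.
  by rewrite -pi_quotientM !phiE fM.
have [s sK] := choice f_surj.
exists (fun b => \pi_Q (s b)) => [u | b]; last by rewrite phiE sK.
elim/quotient_ind: u => x; rewrite phiE.
by apply/(coset_eqP nN)/f_fibre; rewrite sK.
Qed.

Section InnerDerivation.
Variable G : crossedModule.
Implicit Types x y : cm1 G.

Lemma inner_subproof x g h :
  x * act (g * h) x^-1 = (x * act g x^-1) * act g (x * act h x^-1).
Proof. by rewrite actM -actA (actV g x) !mulgA mulgVK. Qed.

Definition inner x : derivation G := Derivation (inner_subproof x).

Lemma innerM : {morph inner : x y / x * y}.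
Proof.
move=> x y; apply: derP => g; rewrite /= /der_comp_fun /=.
(* Composition evaluates [inner x] at [bd w * g] for [w := inner y g]; since
   [bd w] acts as conjugation by [w], the trailing [w] cancels. *)
by rewrite actA peiffer -[_ * (y * _)]mulgA mulgVK invgM actM !mulgA.
Qed.

Lemma inner1 : inner 1 = 1.
Proof. by apply: derP => g; rewrite /= actV actg1 mulgV. Qed.

Lemma inner_mulV x : inner x * inner x^-1 = 1.
Proof. by rewrite -innerM mulgV inner1. Qed.

Lemma inner_Vmul x : inner x^-1 * inner x = 1.
Proof. by rewrite -innerM mulVg inner1. Qed.

Definition inner_unit x : whitehead G := Units (inner_mulV x) (inner_Vmul x).

Lemma inner_unit_DC x : inner_unit x \in DC_subgroup G.
Proof. by apply/asboolP; exists x. Qed.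

Definition inner_DC x : DC G := SubgroupElt (inner_unit_DC x).

Lemma inner_DC_morph : {morph inner_DC : x y / x * y}.
Proof. move=> x y; apply/val_inj/units_val_inj/innerM. Qed.

Lemma inner_DC_surj (d : DC G) : exists x, inner_DC x = d.
Proof.
have /asboolP[x dx] := valP d; exists x.
by apply/val_inj/units_val_inj/derP => g; rewrite dx.
Qed.

(** [act g (x^-1 * y) = x^-1 * y] rearranges to
    [x * act g x^-1 = y * act g y^-1]. *)
Lemma inner_DC_fibre x y : inner_DC x = inner_DC y <-> x^-1 * y \in fixed G.
Proof.
split=> [exy | /asboolP fxy].
  apply/asboolP => g.
  have /(congr1 (fun p : derivation G => p g)) /= exg :=
    congr1 (fun d : DC G => units_val (val d)) exy.
  rewrite actM -[act g y]invgK -actV -[act g y^-1](mulKg y) -exg.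
  by rewrite !invgM invgK -mulgA mulVKg.
apply/val_inj/units_val_inj/derP => g /=.
rewrite -[y](mulVKg x); move: (x^-1 * y) fxy => n fn.
by rewrite invgM actM (actV g n) fn mulgA mulgK.
Qed.

Lemma center_quotient_isomorphic_DC :
  group_isomorphic (cm1 (center_quotient G)) (DC G).
Proof.
exact: (quotient_isomorphic _ inner_DC_morph inner_DC_surj inner_DC_fibre).
Qed.
End InnerDerivation.

Theorem theorem30 (G H : crossedModule) (iso_GH : isoclinic G H) :
  group_isomorphic (DC G) (DC H).
Proof.
have [eta [_ [[eta1_bij _] _ _ _]]] := iso_GH.
apply: group_isomorphic_trans (center_quotient_isomorphic_DC H).
apply: group_isomorphic_trans
  (group_isomorphic_sym (center_quotient_isomorphic_DC G)) _.
by exists (mor1 eta); split=> //; apply: mor1M.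
Qed.
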